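(* Let $\beta_1,\beta_2,\gamma_1,\gamma_2\in\mathbb{C}$ with $\beta_1\neq\beta_2$. Then the initial equation possesses a unique formal fundamental matrix $\hat\Phi_\infty(x,0)$ at $x=\infty$ in the form $$\hat\Phi_\infty(x,0)=\exp\left(-\frac Bx\right)\left(\frac1x\right)^{-\Lambda}\hat P(x)\exp(Gx),\quad G=\mathrm{diag}(\gamma_1,\gamma_2),\ \Lambda=\mathrm{diag}(0,-2),\ B=\mathrm{diag}(\beta_1,\beta_2).$$ The matrix $\hat P(x)$ is defined as follows. (1) If $\gamma_1=\gamma_2$, then $\hat P(x)=\begin{pmatrix}1&\frac{e^{-\frac{\beta_2-\beta_1}{x}}-1}{\beta_2-\beta_1}\\0&1\end{pmatrix}$. (2) If $\gamma_1\neq\gamma_2$, then $\hat P(x)=\begin{pmatrix}1&-\frac{\hat\varphi(x)}{x}\\0&1\end{pmatrix}$, where $\hat\varphi(x)$ is the formal series $$\hat\varphi(x)=\sum_{k=1}^\infty\frac{k!\,S_{k-1}}{(\gamma_2-\gamma_1)^k}\,x^{-k},\qquad S_{k-1}=\sum_{n=0}^{k-1}\frac{(-1)^{n+1}(\gamma_2-\gamma_1)^n(\beta_2-\beta_1)^n}{n!\,(n+1)!}.$$ Moreover, in case (2): (a) if $\lim_{k\to\infty}S_{k-1}\neq0$, then the formal series $\hat\varphi(x)$ is divergent; (b) if $\lim_{k\to\infty}S_{k-1}=0$, then the series $\hat\varphi(x)$ defines a function analytic in $\mathbb{CP}^1\setminus\{0\}$.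
   Context: Initial equation: $L_2(L_1 y)=0$ with $L_1=\partial-\left(\frac{\beta_1}{x^2}+\gamma_1\right)$, $L_2=\partial-\left(-\frac{2}{x}+\frac{\beta_2}{x^2}+\gamma_2\right)$, $\partial=\frac{d}{dx}$. Its fundamental matrices are taken of the form $\begin{pmatrix}\Phi_1&\Phi_{12}\\0&\Phi_2\end{pmatrix}$, where $\Phi_1=e^{\gamma_1x}e^{-\beta_1/x}$ solves $L_1u=0$, $\Phi_2=x^{-2}e^{\gamma_2x}e^{-\beta_2/x}$ solves $L_2u=0$, and $\Phi_{12}(x)=\Phi_1(x)\int_{\Gamma}\frac{\Phi_2(z)}{\Phi_1(z)}\,dz$ (so $L_1\Phi_{12}=\Phi_2$); for the matrix at infinity, $\Gamma$ is a path from $+\infty e^{i\theta}$ to $x$ approaching infinity in the direction $\theta=\arg(\gamma_1-\gamma_2)$ (the positive real direction when $\gamma_1=\gamma_2$). The formal fundamental matrix at $x=\infty$ is obtained by expressing this integral through formal power series in $x^{-1}$: the entries of $\hat P(x)$ are formal power series in $x^{-1}$, and $x^{\Lambda}$, $\exp(Gx)$, $\exp(-B/x)$ are regarded as formal functions. *)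

(* Defs.v *)
From HB Require Import structures.
From mathcomp Require Import all_boot all_order all_algebra.
From mathcomp Require Import finmap.
From mathcomp Require Import all_classical all_reals all_analysis.
From mathcomp Require Import complex ring.

Set Implicit Arguments.
Unset Strict Implicit.
Unset Printing Implicit Defensive.

Import Order.TTheory GRing.Theory Num.Theory.
Import numFieldNormedType.Exports.
Local Open Scope ring_scope.

(* Formal power series in x^-1: f stands for \sum_n f n x^-n. *)
Definition fps (A : Type) := nat -> A.

HB.instance Definition _ (A : zmodType) := GRing.Zmodule.copy (fps A) (nat -> A).

Section FpsRing.
Variable A : comNzRingType.
Implicit Types f g h : fps A.

Definition fps_one : fps A := fun n => (n == 0%N)%:R.
Definition fps_mul f g : fps A := fun n => \sum_(i < n.+1) f i * g (n - i)%N.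

Lemma fps_addE f g n : (f + g) n = f n + g n. Proof. by []. Qed.

Fact fps_mulC : commutative fps_mul.
Proof.
move=> f g; apply/funext => n; rewrite /fps_mul (reindex_inj rev_ord_inj) /=.
by apply: eq_bigr => i _; rewrite subSS subKn -1?ltnS // mulrC.
Qed.

Fact fps_mulA : associative fps_mul.
Proof.
move=> f g h; apply/funext => n; rewrite /fps_mul.
pose F j k := f j * (g (n - j - k)%N * h k).
transitivity (\sum_(j < n.+1) \sum_(k < n.+1 | (k <= n - j)%N) F j k).
  apply: eq_bigr => /= j _; rewrite big_distrr /=.
  rewrite (reindex_inj rev_ord_inj) /=.
  rewrite (big_ord_narrow_leq (leq_subr _ _)); apply: eq_bigr => k _.
  by rewrite subSS /F subKn // -ltnS.
rewrite (exchange_big_dep predT) //= [RHS](reindex_inj rev_ord_inj) /=.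
apply: eq_bigr => k _.
transitivity (\sum_(j < n.+1 | (j <= n - k)%N) F j k).
  apply: eq_bigl => j; rewrite -ltnS -(ltnS j) -!subSn ?leq_ord //.
  by rewrite -subn_gt0 -(subn_gt0 j) -!subnDA addnC.
rewrite subSS (big_ord_narrow_leq (leq_subr _ _)) big_distrl /=.
apply: eq_bigr => j _; rewrite /F mulrA subKn -1?ltnS //; congr (_ * _ * _).
by rewrite -!subnDA addnC.
Qed.

Fact fps_mul1 : left_id fps_one fps_mul.
Proof.
move=> f; apply/funext => n; rewrite /fps_mul big_ord_recl subn0 mul1r.
by rewrite big1 ?addr0 // => i _; rewrite /fps_one mul0r.
Qed.

Fact fps_mulDl : left_distributive fps_mul +%R.
Proof.
move=> f g h; apply/funext => n; rewrite fps_addE -big_split.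
by apply: eq_bigr => i _; rewrite /= mulrDl.
Qed.

Fact fps_one_neq0 : fps_one != 0.
Proof. by apply/eqP => /(congr1 (fun f => f 0%N)) /eqP; rewrite oner_eq0. Qed.

HB.instance Definition _ := GRing.Zmodule_isComNzRing.Build (fps A)
  fps_mulA fps_mulC fps_mul1 fps_mulDl fps_one_neq0.

End FpsRing.

Section ExpSums.
Variables (K : zmodType) (A : comNzRingType).

(* Finite formal sums \sum_k f_k e^{k x}, i.e. the group ring of the additive
   group K over A: f k is the coefficient of e^{k x}. *)
Definition expsum := {fsfun K -> A with 0}.
HB.instance Definition _ := Choice.on expsum.
Implicit Types f g h : expsum.

Definition es_zero : expsum := [fsfun].
Definition es_opp f : expsum := [fsfun k in finsupp f => - f k].
Definition es_add f g : expsum :=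
  [fsfun k in (finsupp f `|` finsupp g)%fset => f k + g k].
Definition es_mono (k : K) (a : A) : expsum := [fsfun _ in [fset k]%fset => a].
Definition es_mul f g : expsum :=
  [fsfun k in [fset (i + j)%R | i in finsupp f, j in finsupp g]%fset =>
    \sum_(i <- finsupp f) f i * g (k - i)].

Fact es_oppE f k : es_opp f k = - f k.
Proof.
by rewrite fsfun_fun; case: finsuppP; rewrite ?oppr0.
Qed.

Fact es_addE f g k : es_add f g k = f k + g k.
Proof.
rewrite fsfun_fun in_fsetU.
by case: finsuppP => _; case: finsuppP => _ //=; rewrite ?addr0.
Qed.

Fact es_monoE k a i : es_mono k a i = if i == k then a else 0.
Proof. by rewrite fsfun_fun in_fset1. Qed.

Fact es_addA : associative es_add.
Proof. by move=> f g h; apply/fsfunP => k; rewrite !es_addE addrA. Qed.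
Fact es_addC : commutative es_add.
Proof. by move=> f g; apply/fsfunP => k; rewrite !es_addE addrC. Qed.
Fact es_add0 : left_id es_zero es_add.
Proof. by move=> f; apply/fsfunP => k; rewrite es_addE fsfunE add0r. Qed.
Fact es_addN : left_inverse es_zero es_opp es_add.
Proof.
by move=> f; apply/fsfunP => k; rewrite es_addE es_oppE addNr fsfunE.
Qed.

HB.instance Definition _ := GRing.isZmodule.Build expsum
  es_addA es_addC es_add0 es_addN.

Lemma es_sum_widen (S : {fset K}) f (F : K -> A) : (finsupp f `<=` S)%fset ->
  \sum_(i <- finsupp f) f i * F i = \sum_(i <- S) f i * F i.
Proof.
move=> sfS; apply: big_fset_incl => // i _ ?.
by rewrite fsfun_dflt ?mul0r.
Qed.

Fact es_mulE f g k : es_mul f g k = \sum_(i <- finsupp f) f i * g (k - i).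
Proof.
rewrite fsfun_fun; case: ifPn => // kN.
apply/esym; rewrite big_seq big1 // => i fi.
rewrite (@fsfun_dflt _ _ _ g (k - i)) ?mulr0 //; apply: contra kN => gi.
by apply/imfset2P; exists i => //; exists (k - i) => //; rewrite addrC subrK.
Qed.

Fact es_mulEw (S : {fset K}) f g k : (finsupp f `<=` S)%fset ->
  es_mul f g k = \sum_(i <- S) f i * g (k - i).
Proof. by move=> sfS; rewrite es_mulE (es_sum_widen _ sfS). Qed.

Fact es_mulC : commutative es_mul.
Proof.
move=> f g; apply/fsfunP => k.
pose S := (finsupp f `|` [fset (k - j)%R | j in finsupp g])%fset.
rewrite (@es_mulEw S) ?fsubsetUl // (@es_mulEw [fset (k - j)%R | j in S]%fset).
  rewrite [RHS]big_imfset; last by move=> i j _ _ /addrI /oppr_inj.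
  by apply: eq_bigr => i _; rewrite subKr mulrC.
apply/fsubsetP => j gj; apply/imfsetP; exists (k - j); last by rewrite subKr.
by rewrite in_fsetU; apply/orP; right; apply/imfsetP; exists j.
Qed.

Fact es_mulA : associative es_mul.
Proof.
move=> f g h; apply/fsfunP => k.
pose S := [fset (i + j)%R | i in finsupp f, j in finsupp g]%fset.
have sS : (finsupp (es_mul f g) `<=` S)%fset by apply: finsupp_sub.
rewrite es_mulE (es_mulEw _ _ sS).
under [RHS]eq_bigr => m _ do rewrite es_mulE big_distrl /=.
rewrite exchange_big /= big_seq [RHS]big_seq; apply: eq_bigr => i fi.
rewrite es_mulE big_distrr /=.
have siS : ([fset (i + j)%R | j in finsupp g] `<=` S)%fset.
  apply/fsubsetP => m /imfsetP [j gj ->]; apply/imfset2P.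
  by exists i => //; exists j.
rewrite -(big_fset_incl _ siS); last first.
  move=> m _ mN; rewrite [g (m - i)]fsfun_dflt ?mulr0 ?mul0r //.
  by apply: contra mN => gm; apply/imfsetP; exists (m - i); rewrite // addrC subrK.
rewrite big_imfset /=; last by move=> a b _ _ /addrI.
by apply: eq_bigr => j _; rewrite mulrA (addrC i) addrK opprD addrA addrAC.
Qed.

Fact es_mul1 : left_id (es_mono 0 1) es_mul.
Proof.
move=> f; apply/fsfunP => k.
rewrite (@es_mulEw [fset 0%R]%fset) ?finsupp_sub //.
by rewrite big_seq_fset1 es_monoE eqxx mul1r subr0.
Qed.

Fact es_mulDl : left_distributive es_mul +%R.
Proof.
move=> f g h; apply/fsfunP => k.
pose S := (finsupp f `|` finsupp g)%fset.
rewrite es_addE !(@es_mulEw S) ?fsubsetUl ?fsubsetUr ?finsupp_sub //.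
by rewrite -big_split; apply: eq_bigr => i _; rewrite es_addE mulrDl.
Qed.

Fact es_mono_neq0 : es_mono 0 1 != 0.
Proof.
apply/eqP => /fsfunP /(_ 0) /eqP.
by rewrite es_monoE eqxx fsfunE oner_eq0.
Qed.

HB.instance Definition _ := GRing.Zmodule_isComNzRing.Build expsum
  es_mulA es_mulC es_mul1 es_mulDl es_mono_neq0.

End ExpSums.

Section FormalFunctions.
Variable C : numFieldType.

Definition fps_cst (c : C) : fps C := fun n => if n == 0%N then c else 0.
Definition fps_xinv : fps C := fun n => (n == 1%N)%:R.
(* exp(b / x) *)
Definition fps_exp (b : C) : fps C := fun n => b ^+ n / n`!%:R.
(* d/dx, with (x^-n)' = - n x^-(n+1); the coefficient of x^0 vanishes since
   0.-1 = 0. *)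
Definition fps_deriv (f : fps C) : fps C := fun n => - (n.-1%:R * f n.-1).

(* The ring of formal functions: finite sums of terms f(x) e^{k x}, with f a
   formal power series in x^-1. *)
Definition formal := Eval cbv beta delta [reverse_coercion] in expsum C (fps C).

Definition ser (f : fps C) : formal := es_mono 0 f.
Definition expx (k : C) : formal := es_mono k 1.
Definition cst (c : C) : formal := ser (fps_cst c).
Definition xinv : formal := ser fps_xinv.

(* d/dx, with (f e^{k x})' = (f' + k f) e^{k x} *)
Definition deriv (u : formal) : formal :=
  [fsfun k in finsupp u => fps_deriv (u k) + fps_cst k * u k].

(* h = \int_{\infty}^x : the primitive with no constant term.  The constants are
   the multiples of x^0 e^{0 x}; a combination of series in x^-1 and of
   e^{k x} times such series, with e^{k x} decaying along the path, tends to 0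
   at infinity iff that coefficient is 0. *)
Definition integral_from_infty (g h : formal) : Prop :=
  deriv h = g /\ (h 0 : fps C) 0%N = 0.

Lemma fps_deriv0 : fps_deriv 0 = 0.
Proof. by apply/funext => n; rewrite /fps_deriv mulr0 oppr0. Qed.

Lemma derivE (u : formal) k : deriv u k = fps_deriv (u k) + fps_cst k * u k.
Proof.
rewrite fsfun_fun; case: finsuppP => // _.
by rewrite fps_deriv0 mulr0 addr0.
Qed.

Lemma deriv_mono k f :
  deriv (es_mono k f) = es_mono k (fps_deriv f + fps_cst k * f).
Proof.
apply/fsfunP => i; rewrite derivE !es_monoE; case: eqP => [->//|_].
by rewrite fps_deriv0 mulr0 addr0.
Qed.

Lemma mono_mul k l (f g : fps C) :
  es_mono k f * es_mono l g = es_mono (k + l) (f * g) :> formal.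
Proof.
apply/fsfunP => i; rewrite [LHS](@es_mulEw _ _ [fset k]%fset) ?finsupp_sub //.
rewrite big_seq_fset1 !es_monoE eqxx subr_eq addrC.
by case: ifP => // _; rewrite mulr0.
Qed.

Lemma fps_derivD f g : fps_deriv (f + g) = fps_deriv f + fps_deriv g.
Proof.
by apply/funext => n; rewrite /fps_deriv !fps_addE mulrDr opprD.
Qed.

Lemma fps_derivM f g : fps_deriv (f * g) = fps_deriv f * g + f * fps_deriv g.
Proof.
have fps_mulE (a b : fps C) n :
  (a * b) n = \sum_(i < n.+1) a i * b (n - i)%N by [].
have deriv_at0 (a : fps C) : fps_deriv a 0%N = 0.
  by rewrite /fps_deriv mul0r oppr0.
apply/funext => -[|n]; rewrite fps_addE !fps_mulE.
  by rewrite !big_ord1 !deriv_at0 mul0r mulr0 addr0.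
rewrite big_ord_recl [X in _ + X]big_ord_recr /= subnn !deriv_at0.
rewrite mul0r mulr0 add0r addr0 -big_split [LHS]/fps_deriv /= fps_mulE.
rewrite mulr_sumr -sumrN; apply: eq_bigr => i _; have le_in := ltn_ord i.
rewrite ltnS in le_in; rewrite /fps_deriv /= /bump /= add1n subSS subSn //=.
rewrite -{1}(subnKC le_in) natrD.
by ring.
Qed.

Lemma derivM (u v : formal) : deriv (u * v) = deriv u * v + u * deriv v.
Proof.
apply/fsfunP => k; rewrite derivE es_addE.
rewrite [(u * v) k]es_mulE [(deriv u * v) k](@es_mulEw _ _ (finsupp u)).
  rewrite [(u * deriv v) k]es_mulE mulr_sumr.
  have -> (I : seq C) (F : C -> fps C) :
      fps_deriv (\sum_(i <- I) F i) = \sum_(i <- I) fps_deriv (F i).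
    by apply: big_morph; [exact: fps_derivD | exact: fps_deriv0].
  rewrite -!big_split /=; apply: eq_bigr => i _.
  rewrite !derivE fps_derivM.
  have -> : fps_cst k = fps_cst i + fps_cst (k - i).
    apply/funext => n; rewrite fps_addE /fps_cst.
    by case: ifP => _; rewrite ?addr0 // addrC subrK.
  by rewrite !mulrDl !mulrDr; ring.
exact: finsupp_sub.
Qed.

End FormalFunctions.

Definition mx2 (A : Type) (a b c d : A) : 'M[A]_2 :=
  \matrix_(i, j) if i == 0 then (if j == 0 then a else b)
                 else (if j == 0 then c else d).

Section Equation.
Variables (C : numFieldType) (beta1 beta2 gamma1 gamma2 : C).

Definition L1 (u : formal C) : formal C :=
  deriv u - (cst beta1 * xinv C ^+ 2 + cst gamma1) * u.
Definition L2 (u : formal C) : formal C :=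
  deriv u - (- (cst 2 * xinv C) + cst beta2 * xinv C ^+ 2 + cst gamma2) * u.

(* Formal fundamental matrix of L2 (L1 y) = 0, written as the first-order system
   L1 y1 = y2, L2 y2 = 0. *)
Definition fundamental_matrix (Phi : 'M[formal C]_2) : Prop :=
  [/\ forall j, L2 (L1 (Phi 0 j)) = 0,
      forall j, Phi 1 j = L1 (Phi 0 j)
    & \det Phi != 0].

Definition Phi1 : formal C := expx gamma1 * ser (fps_exp (- beta1)).
Definition Phi2 : formal C :=
  xinv C ^+ 2 * expx gamma2 * ser (fps_exp (- beta2)).

(* The normalisation at infinity: Phi12 = Phi1 \int_\infty^x Phi2 / Phi1, where
   q is the quotient Phi2 / Phi1 (Phi1 is invertible in formal C). *)
Definition fundamental_matrix_infty (Phi : 'M[formal C]_2) : Prop :=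
  fundamental_matrix Phi /\
  exists q h : formal C,
    [/\ q * Phi1 = Phi2, integral_from_infty q h
      & Phi = mx2 Phi1 (Phi1 * h) 0 Phi2].

(* exp(-B/x) (1/x)^{-Lambda} P(x) exp(Gx), with -Lambda = diag(0, 2) *)
Definition Phi_infty (P : 'M[fps C]_2) : 'M[formal C]_2 :=
  mx2 (ser (fps_exp (- beta1))) 0 0 (ser (fps_exp (- beta2)))
  *m mx2 (xinv C ^+ 0) 0 0 (xinv C ^+ 2)
  *m map_mx (@ser C) P
  *m mx2 (expx gamma1) 0 0 (expx gamma2).

(* partial_S k is S_k, so that partial_S k.-1 is the S_{k-1} of \hat\varphi *)
Definition partial_S (k : nat) : C :=
  \sum_(0 <= n < k.+1) (-1) ^+ n.+1 * (gamma2 - gamma1) ^+ n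
    * (beta2 - beta1) ^+ n / (n`! * (n.+1)`!)%:R.

(* the formal series \hat\varphi, coefficient of x^-k at index k *)
Definition phi_hat : fps C := fun k =>
  if k == 0%N then 0 else k`!%:R * partial_S k.-1 / (gamma2 - gamma1) ^+ k.

End Equation.

Section Convergence.
Variable C : numFieldType.

Definition fps_divergent (f : fps C) : Prop :=
  forall x : C, x != 0 -> ~ cvgn (series (fun k => f k * x ^- k)).

(* The Riemann sphere: Some x is the point x of C, None is the point infinity *)
Definition CP1 := option C.

(* analytic = complex differentiable in a neighbourhood; derivable is taken over
   the base field C itself *)
Definition analytic_at (g : C -> C) (z : C) : Prop :=
  \forall w \near z, derivable g w 1.

(* 1/x on CP1 \ {0}, the value at Some 0 being irrelevant *)
Definition inv_coord (p : CP1) : C := if p is Some x then x^-1 else 0.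
Definition chart_infty (t : C) : CP1 := if t == 0 then None else Some t^-1.

Definition analytic_on (U : set CP1) (F : CP1 -> C) : Prop :=
  forall p, U p ->
    if p is Some x then analytic_at (fun z => F (Some z)) x
    else analytic_at (fun t => F (chart_infty t)) 0.

Definition fps_sums_to_on (U : set CP1) (f : fps C) (F : CP1 -> C) : Prop :=
  forall p, U p -> (series (fun k => f k * inv_coord p ^+ k) @ \oo --> F p)%classic.

End Convergence.

Definition cplx (R : realType) : numClosedFieldType := R[i].

(* Main.v *)
(* All the entries live on the monomials e^{kx}, so the problem reduces to the
   scalar equation p' + (gamma2 - gamma1) p = x^-2 e^{-(beta2 - beta1)/x} for the
   upper right entry p of P: it determines p coefficient by coefficient, up to a
   constant when gamma1 = gamma2.  Write g = gamma2 - gamma1, b = beta2 - beta1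
   and phi_k for the coefficients of phi, so that phi_k = k! S_{k-1} / g^k.
   If \sum phi_k x^-k converged for some x <> 0, then S_{k-1}, which is the
   product of phi_k x^-k by (g x)^k / k!, would tend to 0.  Conversely, if S_k
   tends to 0, then -S_{k-1} is a tail of the series of terms bounded by
   |g b|^n / (n! (n+1)!), whence |phi_k| <= e^{|g b|} |b|^k / k!, so that phi is
   entire in 1/x. *)
Require Import Defs.
From HB Require Import structures.
From mathcomp Require Import all_boot all_order all_algebra.
From mathcomp Require Import all_classical all_reals all_analysis.
From mathcomp Require Import finmap complex ring.
Import Order.TTheory GRing.Theory Num.Theory.
Import numFieldNormedType.Exports.
Local Open Scope ring_scope.
Local Open Scope classical_set_scope.

(** * Calculus of power series in x^-1 and of formal functions *)

Section Formal.
Variable C : numFieldType.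
Implicit Types (f g p : fps C) (u v : formal C) (k l : C).

Lemma fps_mulE f g n : (f * g) n = \sum_(i < n.+1) f i * g (n - i)%N.
Proof. by []. Qed.

Lemma fps_oppE f n : (- f) n = - f n.
Proof. by []. Qed.

Lemma fps_cst_mul c f n : (fps_cst c * f) n = c * f n.
Proof.
rewrite fps_mulE big_ord_recl subn0 big1 ?addr0 // => i _.
by rewrite /fps_cst /= mul0r.
Qed.

Lemma fps_cst0 : fps_cst (0 : C) = 0.
Proof. by apply/funext => -[]. Qed.

Lemma fps_cst1 : fps_cst (1 : C) = 1.
Proof. by apply/funext => -[]. Qed.

Lemma fps_cstN c : fps_cst (- c : C) = - fps_cst c.
Proof. by apply/funext => -[|n]; rewrite fps_oppE //= /fps_cst oppr0. Qed.

Lemma fps_xinv_mul0 f : (fps_xinv C * f) 0%N = 0.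
Proof. by rewrite fps_mulE big_ord1 mul0r. Qed.

Lemma fps_xinv_mulS f n : (fps_xinv C * f) n.+1 = f n.
Proof.
rewrite fps_mulE 2!big_ord_recl /= /bump /= mul0r add0r mul1r subSS subn0.
by rewrite big1 ?addr0 // => i _; rewrite mul0r.
Qed.

Lemma fps_exp0 : fps_exp (0 : C) = 1.
Proof.
apply/funext => -[|n]; rewrite /fps_exp; first by rewrite divr1.
by rewrite expr0n mul0r.
Qed.

(** The binomial theorem, read off in each coefficient of the Cauchy product. *)
Lemma fps_expD (a c : C) : fps_exp (a + c) = fps_exp a * fps_exp c.
Proof.
apply/funext => n; rewrite fps_mulE /fps_exp addrC exprDn mulr_suml.
apply: eq_bigr => i _.
have le_in : (i <= n)%N by rewrite -ltnS.
rewrite -mulr_natr -(bin_fact le_in) !natrM.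
have f0 m : m`!%:R != 0 :> C by rewrite pnatr_eq0 -lt0n fact_gt0.
have b0 : 'C(n, i)%:R != 0 :> C by rewrite pnatr_eq0 -lt0n bin_gt0.
by field; rewrite !f0 b0.
Qed.

Lemma fps_expK (a : C) : fps_exp a * fps_exp (- a) = 1.
Proof. by rewrite -fps_expD subrr fps_exp0. Qed.

Lemma fps_deriv_exp (a : C) :
  fps_deriv (fps_exp a) = - (fps_cst a * (fps_xinv C ^+ 2 * fps_exp a)).
Proof.
apply/funext => n; rewrite fps_oppE fps_cst_mul expr2 -mulrA /fps_deriv.
congr (- _); case: n => [|[|n]] /=; rewrite ?fps_xinv_mul0 ?mul0r ?mulr0 //.
  by rewrite fps_xinv_mulS fps_xinv_mul0 mulr0.
rewrite !fps_xinv_mulS /fps_exp factS natrM exprS.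
have f0 : n`!%:R != 0 :> C by rewrite pnatr_eq0 -lt0n fact_gt0.
have n0 : n.+1%:R != 0 :> C by rewrite pnatr_eq0.
by move: n.+1%:R n`!%:R n0 f0 => N F n0 f0; field; rewrite f0 n0.
Qed.

Lemma fps_deriv_cst (c : C) : fps_deriv (fps_cst c) = 0.
Proof.
by apply/funext => -[|[|n]]; rewrite /fps_deriv /fps_cst /= ?mul0r ?mulr0 ?oppr0.
Qed.

Lemma fps_deriv_xinv : fps_deriv (fps_xinv C) = - fps_xinv C ^+ 2.
Proof.
apply/funext => -[|[|[|n]]]; rewrite /fps_deriv fps_oppE expr2 /=;
  rewrite ?fps_xinv_mul0 ?fps_xinv_mulS /fps_xinv /= ?mul0r ?mulr1 ?mulr0 //.
Qed.

(** For k <> 0 the coefficient of x^-n expresses k f_n through f_(n-1), so the coefficients follow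
    by recursion. For k = 0 the derivative loses only the constant term, hence the extra
    condition. *)
Lemma fps_ode_inj k f g :
    fps_deriv f + fps_cst k * f = fps_deriv g + fps_cst k * g ->
  (k = 0 -> f 0%N = g 0%N) -> f = g.
Proof.
move=> fg fg0.
have {}fg n : - (n.-1%:R * f n.-1) + k * f n = - (n.-1%:R * g n.-1) + k * g n.
  by have := congr1 (@^~ n) fg; rewrite !fps_addE !fps_cst_mul.
apply/funext; case: (eqVneq k 0) => [k0|k0].
  case=> [|n]; first exact: fg0.
  have := fg n.+2; rewrite k0 !mul0r !addr0 => /oppr_inj /=.
  by apply: mulfI; rewrite pnatr_eq0.
elim=> [|n IHn]; have := fg; [move/(_ 0%N)|move/(_ n.+1)] => /=.
  by rewrite !mul0r oppr0 !add0r => /(mulfI k0).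
by rewrite IHn => /addrI /(mulfI k0).
Qed.

(** The derivative acts separately on each e^{kx}, and an integration constant can occur only at k =
    0. This makes the integral from infinity unique. *)
Lemma deriv_inj u v : Defs.deriv u = Defs.deriv v ->
  (u 0 : fps C) 0%N = (v 0 : fps C) 0%N -> u = v.
Proof.
move=> uv uv0; apply/fsfunP => k.
apply: (@fps_ode_inj k); last by move=> ->.
by rewrite -!Defs.derivE uv.
Qed.

Lemma es_mono_inj k : injective (es_mono k : fps C -> formal C).
Proof. by move=> f g /fsfunP /(_ k); rewrite !es_monoE eqxx. Qed.

Lemma es_monoN k f : - es_mono k f = es_mono k (- f) :> formal C.
Proof.
by apply/fsfunP => i; rewrite [LHS]es_oppE !es_monoE; case: ifP; rewrite ?oppr0.
Qed.

Lemma es_monoD k f g : es_mono k f + es_mono k g = es_mono k (f + g) :> formal C.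
Proof.
by apply/fsfunP => i; rewrite [LHS]es_addE !es_monoE; case: ifP; rewrite ?addr0.
Qed.

Lemma es_mono0 k : es_mono k 0 = 0 :> formal C.
Proof. by apply/fsfunP => i; rewrite es_monoE fsfunE; case: ifP. Qed.

Lemma serX f n : ser f ^+ n = ser (f ^+ n).
Proof.
elim: n => [|n IHn]; first by rewrite !expr0.
by rewrite !exprS IHn [LHS]mono_mul addr0.
Qed.

Lemma mx2E (A : Type) (a b c d : A) (M : 'M[A]_2) :
  M 0 0 = a -> M 0 1 = b -> M 1 0 = c -> M 1 1 = d -> M = mx2 a b c d.
Proof.
move=> <- <- <- <-; apply/matrixP => i j; rewrite mxE.
by case: (unliftP 0 i) => [i'|] ->; case: (unliftP 0 j) => [j'|] -> //=;
  rewrite ?(ord1 i') ?(ord1 j') //; congr (M _ _); apply/val_inj.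
Qed.

(** * The formal fundamental matrix and its scalar equation *)

Section Equation.
Variables beta1 beta2 gamma1 gamma2 : C.
Notation Y1 := (Phi1 beta1 gamma1).
Notation Y2 := (Phi2 beta2 gamma2).
Notation X := (fps_xinv C).
Notation E := (@fps_exp C).

Lemma Phi1E : Y1 = es_mono gamma1 (E (- beta1)).
Proof. by rewrite /Phi1 [LHS]mono_mul addr0 mul1r. Qed.

Lemma Phi2E : Y2 = es_mono gamma2 (X ^+ 2 * E (- beta2)).
Proof. by rewrite /Phi2 serX /ser /expx !mono_mul addr0 add0r mulr1. Qed.

Lemma Phi1_inv : Y1 * es_mono (- gamma1) (E beta1) = 1.
Proof.
by rewrite Phi1E mono_mul subrr mulrC -{1}[beta1]opprK [E _ * _]mulrC fps_expK.
Qed.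

Lemma L1_Phi1 : L1 beta1 gamma1 Y1 = 0.
Proof.
rewrite /L1 Phi1E Defs.deriv_mono fps_deriv_exp fps_cstN serX /Defs.cst /ser.
rewrite !mono_mul addr0 es_monoD mono_mul es_monoN add0r.
by rewrite es_monoD -[RHS](es_mono0 gamma1); congr es_mono; ring.
Qed.

Lemma L2_Phi2 : L2 beta2 gamma2 Y2 = 0.
Proof.
have cst2 : fps_cst (2 : C) = 1 + 1.
  by rewrite -fps_cst1; apply/funext => -[|n]; rewrite fps_addE /= ?addr0.
rewrite /L2 Phi2E Defs.deriv_mono expr2 !fps_derivM fps_deriv_xinv.
rewrite fps_deriv_exp fps_cstN serX /Defs.cst /ser cst2 !mono_mul es_monoN.
rewrite !addr0 !es_monoD mono_mul es_monoN add0r es_monoD.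
by rewrite -[RHS](es_mono0 gamma2); congr es_mono; ring.
Qed.

(** Variation of constants: the terms without derivative of u cancel because [Phi1] solves L1 u =
    0. *)
Lemma L1_Phi1M u : L1 beta1 gamma1 (Y1 * u) = Y1 * Defs.deriv u.
Proof.
have /eqP := L1_Phi1; rewrite /L1 subr_eq0 => /eqP dY.
by rewrite Defs.derivM dY; ring.
Qed.

Lemma Phi_inftyE P : Phi_infty beta1 beta2 gamma1 gamma2 P =
  mx2 (es_mono gamma1 (E (- beta1) * P 0 0))
      (es_mono gamma2 (E (- beta1) * P 0 1))
      (es_mono gamma1 (E (- beta2) * X ^+ 2 * P 1 0))
      (es_mono gamma2 (E (- beta2) * X ^+ 2 * P 1 1)).
Proof.
have lift01 : lift ord0 ord0 = 1 :> 'I_2 by apply/val_inj.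
rewrite /Phi_infty [xinv C ^+ 2]serX expr0.
apply: mx2E; rewrite !mxE !big_ord_recl !big_ord0 !mxE /=;
rewrite !big_ord_recl !big_ord0 !mxE /= !big_ord_recl !big_ord0 !mxE /=;
rewrite ?(mulr0, mul0r, addr0, add0r, mulr1) /ser /expx !mono_mul;
by rewrite ?lift01 ?addr0 ?add0r ?mulr1.
Qed.

(** Each entry of P is multiplied by some e^{kx}, an invertible exponential series and possibly
    x^-2, and all these operations are injective. Uniqueness of the fundamental matrix thus carries
    over to P. *)
Lemma Phi_infty_inj P Q :
  Phi_infty beta1 beta2 gamma1 gamma2 P = Phi_infty beta1 beta2 gamma1 gamma2 Q ->
  P = Q.
Proof.
have EI c : injective (fun f => E (- c) * f).
  by apply: (can_inj (g := fun f => E c * f)) => f; rewrite mulrA fps_expK mul1r.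
(* Multiplication by x^-1 shifts the coefficients up by one; composing with the successor undoes the
   shift. *)
have XI : injective (fun f => X * f).
  move=> f g /= /(congr1 (fun h : fps C => h \o S)) fg; apply/funext => n.
  by have := congr1 (@^~ n) fg; rewrite /= !fps_xinv_mulS.
rewrite !Phi_inftyE => /matrixP PQ.
rewrite (@mx2E _ _ _ _ _ P erefl erefl erefl erefl).
rewrite (@mx2E _ _ _ _ _ Q erefl erefl erefl erefl).
have := PQ 0 0; have := PQ 0 1; have := PQ 1 0; have := PQ 1 1.
rewrite !mxE /= expr2 -!mulrA.
by do 2!move/es_mono_inj/EI/XI/XI ->; do 2!move/es_mono_inj/EI ->.
Qed.

(** Only the primitive h could vary: the quotient q is fixed because [Phi1] is invertible, and h is
    then fixed by its derivative and its zero constant term. *)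
Lemma fundamental_matrix_infty_unique Phi Psi :
  fundamental_matrix_infty beta1 beta2 gamma1 gamma2 Phi ->
  fundamental_matrix_infty beta1 beta2 gamma1 gamma2 Psi -> Phi = Psi.
Proof.
move=> [_ [q [h [qY [dh h0] ->]]]] [_ [q' [h' [qY' [dh' h0'] ->]]]].
suff -> : h = h' by [].
apply: deriv_inj; last by rewrite h0 h0'.
have YI : injective (fun u => u * Y1).
  by apply: (can_inj (g := fun u => u * es_mono (- gamma1) (E beta1))) => u;
    rewrite -mulrA Phi1_inv mulr1.
by rewrite dh dh'; apply: YI; rewrite qY qY'.
Qed.

(** The primitive is h = p e^{(gamma2 - gamma1) x}, and the equation on p says exactly that h' =
    Phi2 / Phi1. If gamma1 = gamma2, then h has exponent 0 and the normalisation at infinity forces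
    p_0 = 0. *)
Lemma fundamental_matrix_infty_mx2 p :
    fps_deriv p + fps_cst (gamma2 - gamma1) * p
      = X ^+ 2 * E (- (beta2 - beta1)) ->
    (gamma2 = gamma1 -> p 0%N = 0) ->
  fundamental_matrix_infty beta1 beta2 gamma1 gamma2
    (Phi_infty beta1 beta2 gamma1 gamma2 (mx2 1 p 0 1)).
Proof.
move=> dp p0; set h := es_mono (gamma2 - gamma1) p : formal C.
have PhiE : Phi_infty beta1 beta2 gamma1 gamma2 (mx2 1 p 0 1) = mx2 Y1 (Y1 * h) 0 Y2.
  rewrite Phi_inftyE !mxE /= !mulr1 mulr0 es_mono0 Phi1E Phi2E mono_mul.
  by rewrite addrC subrK [E _ * X ^+ 2]mulrC.
have dY : Y1 * Defs.deriv h = Y2.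
  rewrite /h Defs.deriv_mono dp Phi1E Phi2E mono_mul addrC subrK opprB.
  rewrite mulrCA fps_expD [E beta1 * _]mulrC [E (- beta1) * _]mulrC.
  by rewrite -mulrA fps_expK mulr1.
have L10 : L1 beta1 gamma1 0 = 0.
  by rewrite /L1 mulr0 subr0 -(es_mono0 0) Defs.deriv_mono fps_deriv0 mulr0 addr0.
have L20 : L2 beta2 gamma2 0 = 0.
  by rewrite /L2 mulr0 subr0 -(es_mono0 0) Defs.deriv_mono fps_deriv0 mulr0 addr0.
rewrite PhiE; split; first split.
- move=> j; rewrite mxE /=; case: ifP => _; first by rewrite L1_Phi1 L20.
  by rewrite L1_Phi1M dY L2_Phi2.
- by move=> j; rewrite !mxE /=; case: ifP => _; rewrite ?L1_Phi1 ?L1_Phi1M.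
- rewrite -det_tr det_trig; last first.
    apply/is_trig_mxP => i j; rewrite !mxE.
    by case: (unliftP 0 i) => [i'|] ->; case: (unliftP 0 j) => [j'|] -> //;
      rewrite ?(ord1 i') ?(ord1 j').
  rewrite !big_ord_recl big_ord0 mulr1 !mxE /= Phi1E Phi2E mono_mul mulrCA -fps_expD.
  (* The determinant is the single term Phi1 Phi2, with exponent gamma1 + gamma2; its series starts
     with x^-2, with coefficient 1. *)
  apply/eqP => /fsfunP /(_ (gamma1 + gamma2)) /(congr1 (fun f : fps C => f 2%N)).
  rewrite es_monoE eqxx fsfunE expr2 -mulrA !fps_xinv_mulS /fps_exp divr1.
  by apply/eqP; rewrite oner_eq0.
exists (Defs.deriv h), h; split=> //; first by rewrite mulrC.
split=> //; rewrite es_monoE; case: eqP => // /esym /eqP.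
by rewrite subr_eq0 => /eqP /p0.
Qed.

Lemma fps_exp_primitive (b : C) : b != 0 ->
  let p := fps_cst b^-1 * (E (- b) - 1) in
  fps_deriv p = X ^+ 2 * E (- b) /\ p 0%N = 0.
Proof.
move=> b0 p; split.
  have cE : fps_cst b^-1 * fps_cst b = 1 :> fps C.
    rewrite -fps_cst1; apply/funext => -[|n]; rewrite fps_cst_mul /fps_cst /= ?mulr0 //.
    by rewrite mulVf.
  rewrite /p -fps_cst1 -fps_cstN fps_derivM fps_derivD !fps_deriv_cst mul0r.
  by rewrite add0r addr0 fps_deriv_exp fps_cstN mulNr opprK mulrA cE mul1r.
by rewrite /p fps_cst_mul fps_addE fps_oppE /fps_exp divr1 subrr mulr0.
Qed.

Lemma partial_SS n : let S := partial_S beta1 beta2 gamma1 gamma2 in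
  S n.+1 = S n + (-1) ^+ n.+2 * (gamma2 - gamma1) ^+ n.+1
    * (beta2 - beta1) ^+ n.+1 / (n.+1`! * n.+2`!)%:R.
Proof. by rewrite /partial_S big_nat_recr. Qed.

Lemma phi_hat_ode : gamma1 != gamma2 ->
  let p := - (X * phi_hat beta1 beta2 gamma1 gamma2) in
  fps_deriv p + fps_cst (gamma2 - gamma1) * p = X ^+ 2 * E (- (beta2 - beta1)).
Proof.
rewrite eq_sym -subr_eq0 => g0 p; apply/funext => n.
rewrite fps_addE fps_cst_mul /fps_deriv /p expr2 -mulrA !fps_oppE.
case: n => [|[|n]] /=.
- by rewrite !fps_xinv_mul0 mul0r oppr0 mulr0 addr0.
- by rewrite !fps_xinv_mulS !fps_xinv_mul0 /phi_hat /= mul0r !oppr0 mulr0 addr0.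
(* At x^-(n+2) the equation reads (n+1) phi_n - g phi_(n+1) = (-b)^n / n!, which is the step from
   S_(n-1) to S_n multiplied by -(n+1)! / g^n. The case n = 0 is apart, since phi_0 = 0 by
   convention. *)
rewrite !fps_xinv_mulS /phi_hat /=; case: n => [|n] /=.
  rewrite /partial_S big_nat1 /fps_exp -[0`!]/1%N -[1`!]/1%N muln1; field.
  by rewrite g0.
rewrite partial_SS /fps_exp.
have f0 : n.+1`!%:R != 0 :> C by rewrite pnatr_eq0 -lt0n fact_gt0.
have n0 : n.+2%:R != 0 :> C by rewrite pnatr_eq0.
rewrite (natrM _ n.+1`! n.+2`!) [n.+2`!]factS (natrM _ n.+2).
rewrite [(- (beta2 - beta1)) ^+ _]exprNn.
move: (partial_S _ _ _ _ _) => S.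
move: n.+2%:R n.+1`!%:R n0 f0 => N F n0 f0.
set g := gamma2 - gamma1 in g0 *; set b := beta2 - beta1.
have gn : g ^+ n != 0 by rewrite expf_neq0.
rewrite !exprS; field.
by rewrite g0 f0 n0 gn.
Qed.

End Equation.
End Formal.

(** * Dominated convergence of complex series *)

Section ComplexSeries.
Variable R : realType.
Local Notation C := (cplx R).
Local Notation "x %:C" := (real_complex R x : C).
Implicit Types (x y : R) (z t : C).

(** The norm takes its values in the complex field; this form moves estimates to the reals, where
    comparison of series and [expR] apply. *)
Lemma normc_ReE z : `|z| = (complex.Re `|z|)%:C.
Proof. by case: z. Qed.

Lemma Re_norm_ge0 z : 0 <= complex.Re `|z|.
Proof. by rewrite -ler0c -normc_ReE. Qed.

Lemma norm_real_complex x : `|x%:C| = `|x|%:C.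
Proof. by rewrite normc_def /= expr0n addr0 sqrtr_sqr. Qed.

Lemma gt0_complexP (e : C) : 0 < e -> exists2 x, 0 < x & e = x%:C.
Proof.
by case: e => x y; rewrite ltcE /= => /andP[/eqP -> x0]; exists x.
Qed.

Lemma cvg_real_complex (u : nat -> R) (l : R) :
  u @ \oo --> l -> (fun n => (u n)%:C) @ \oo --> l%:C.
Proof.
move=> ul; apply/cvgrPdist_lt => _ /gt0_complexP[e e0 ->].
have /cvgrPdist_lt/(_ _ e0) := ul; apply: filterS => n.
by rewrite -rmorphB norm_real_complex ltcR.
Qed.

Lemma norm_lim_le (u : nat -> C) (l M : C) :
  u @ \oo --> l -> (forall n, `|u n| <= M) -> `|l| <= M.
Proof.
move=> ul uM; apply/ler_addgt0Pr => e e0.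
have /cvgrPdist_lt/(_ _ e0)[n _ /(_ n (leqnn n)) lu] := ul.
by rewrite -(subrK (u n) l) (le_trans (ler_normD _ _)) // addrC lerD // ltW.
Qed.

(** The real and imaginary parts converge absolutely by comparison with v; their sums are then
    recombined. *)
Lemma cvg_series_dominated (u : nat -> C) (v : nat -> R) :
  (forall n, `|u n| <= (v n)%:C) -> cvgn (series v) -> cvgn (series u).
Proof.
move=> uv cv.
have dom (w : nat -> R) : (forall n, `|w n| <= v n) -> cvgn (series w).
  move=> wv; apply: normed_cvg; apply: series_le_cvg cv => n //=.
  exact: le_trans (normr_ge0 _) (wv n).
have /cvg_ex[/= a ca] : cvgn (series (fun n => complex.Re (u n))).
  apply: dom => n; rewrite -lecR (le_trans _ (uv n)) //.
  exact: normc_ge_Re.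
have /cvg_ex[/= c cc] : cvgn (series (fun n => complex.Im (u n))).
  apply: dom => n; rewrite -lecR (le_trans _ (uv n)) //.
  rewrite normc_def lecR -sqrtr_sqr ler_wsqrtr // lerDr sqr_ge0 //.
suff : series u @ \oo --> a%:C + 'i%C * c%:C by apply: cvgP.
have -> : series u = fun n => (series (fun n => complex.Re (u n)) n)%:C
    + 'i%C * (series (fun n => complex.Im (u n)) n)%:C.
  apply/funext => n; rewrite /series /= !rmorph_sum /= mulr_sumr -big_split /=.
  by apply: eq_bigr => i _; rewrite [LHS]complexE.
apply: cvgD; first exact: cvg_real_complex.
by apply: cvgM; [exact: cvg_cst | exact: cvg_real_complex].
Qed.

End ComplexSeries.

Arguments normc_ReE {R} z.
Arguments Re_norm_ge0 {R} z.

(** * Second-order Taylor remainder of a monomial *)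

Section TaylorRemainder.
Variable K : numFieldType.
Implicit Types (s t h : K).

Lemma mulrn_expr_pred_le s k : 0 <= s -> s ^+ k.-1 *+ k <= (s + 1) ^+ k.
Proof.
move=> s0; have s10 : 0 <= s + 1 by rewrite addr_ge0.
elim: k => [|[|k] IHk]; rewrite ?expr1 ?mulr1n ?expr0 ?lerDr //.
rewrite /= mulrS exprS [leRHS]exprS mulrDl mul1r addrC.
rewrite lerD //; last first.
  by rewrite -exprS lerXn2r ?nnegrE ?lerDl.
by rewrite -mulrnAr ler_wpM2l.
Qed.

(** The remainders satisfy R_(k+1) = (t + h) R_k + h^2 k t^(k-1). The bound follows by induction
    from |t| + 2 = (|t| + 1) + 1, one summand for each term. *)
Lemma expr_taylor2_le t h k : `|h| <= 1 ->
  `|(t + h) ^+ k - t ^+ k - h * (t ^+ k.-1 *+ k)| <= `|h| ^+ 2 * (`|t| + 2) ^+ k.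
Proof.
move=> h1; have t0 := normr_ge0 t.
have t2 : 0 <= `|t| + 2 by rewrite addr_ge0.
elim: k => [|k IHk].
  by rewrite !expr0 mulr0n mulr0 subr0 subrr normr0 mulr1 exprn_ge0.
have -> : (t + h) ^+ k.+1 - t ^+ k.+1 - h * (t ^+ k *+ k.+1) =
    (t + h) * ((t + h) ^+ k - t ^+ k - h * (t ^+ k.-1 *+ k))
    + h ^+ 2 * (t ^+ k.-1 *+ k).
  case: k {IHk} => [|k] /=; first by rewrite !expr0 !mulr0n; ring.
  rewrite -[_ *+ k.+1]mulr_natl -[_ *+ k.+2]mulr_natl -[k.+2%:R]natr1 !exprS.
  by move: k.+1%:R (t ^+ k) ((t + h) ^+ k) => N x y; ring.
apply: le_trans (ler_normD _ _) _.
rewrite normrM [X in _ + X]normrM (normrX 2 h) normrMn normrX.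
have -> : `|h| ^+ 2 * (`|t| + 2) ^+ k.+1 = (`|t| + 1) * (`|h| ^+ 2 * (`|t| + 2) ^+ k)
    + `|h| ^+ 2 * (`|t| + 2) ^+ k by rewrite [_ ^+ k.+1]exprS; ring.
apply: lerD.
  apply: ler_pM => //; apply: le_trans (ler_normD _ _) _.
  by rewrite lerD2l.
apply: ler_wpM2l; first exact: exprn_ge0.
apply: le_trans (mulrn_expr_pred_le _ _ t0) _.
by rewrite lerXn2r ?nnegrE ?addr_ge0 // lerD2l ler1n.
Qed.

End TaylorRemainder.

(** * Power series with coefficients bounded by A r^k / k! *)

Section EntireSeries.
Variables (R : realType) (a : nat -> cplx R) (A r : R).
Hypotheses (A0 : 0 <= A) (r0 : 0 <= r).
Local Notation C := (cplx R).
Local Notation "x %:C" := (real_complex R x : C).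
Hypothesis ha : forall k, `|a k| <= (A * (r ^+ k / k`!%:R))%:C.
Implicit Types (z t h : C) (s : R).

(** The factor c is arbitrary so that one bound serves for t^k, for k t^(k-1) and for the majorant
    of the Taylor remainder. *)
Let coeff_le (c : nat -> C) s k : 0 <= s ->
  `|c k| <= (s ^+ k)%:C -> `|a k * c k| <= (A * exp_coeff (r * s) k)%:C.
Proof.
move=> s0 cs; rewrite normrM (le_trans (ler_pM _ _ (ha k) cs)) // -rmorphM lecR.
by rewrite /exp_coeff /= exprMn -mulrA [in leRHS]mulrAC.
Qed.

Let cvg_dom s : cvgn (series (fun k => A * exp_coeff (r * s) k)).
Proof. by apply: is_cvg_seriesZ; exact: is_cvg_series_exp_coeff. Qed.

Let sum_le s n : 0 <= s ->
  \sum_(0 <= k < n) A * exp_coeff (r * s) k <= A * expR (r * s).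
Proof.
move=> s0; rewrite -mulr_sumr ler_wpM2l //.
apply: (@nondecreasing_cvgn_le _ (series (exp_coeff (r * s)))).
  by apply: nondecreasing_series => k _ _; rewrite exp_coeff_ge0 // mulr_ge0.
exact: is_cvg_series_exp_coeff.
Qed.

Lemma is_cvg_entire_series t : cvgn (series (fun k => a k * t ^+ k)).
Proof.
apply: cvg_series_dominated (cvg_dom (complex.Re `|t|)) => k.
apply: (@coeff_le (fun k => t ^+ k)); first exact: Re_norm_ge0.
by rewrite normrX normc_ReE -rmorphXn.
Qed.

(** Summing the Taylor remainders of the monomials gives |f(t + h) - f(t) - h g| <= M |h|^2 for |h|
    <= 1, where g is the sum of the series differentiated term by term. *)
Lemma derivable_entire_series t :
  derivable (fun z => limn (series (fun k => a k * z ^+ k))) t 1.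
Proof.
set f := fun z => _; set s := complex.Re `|t|.
have s0 : 0 <= s by exact: Re_norm_ge0.
have tE : `|t| = s%:C by exact: normc_ReE.
have cf z : series (fun k => a k * z ^+ k) @ \oo --> f z by exact: is_cvg_entire_series.
pose d := series (fun k => a k * (t ^+ k.-1 *+ k)).
have /cvg_ex[/= g0 dg] : cvgn d.
  apply: cvg_series_dominated (cvg_dom (s + 1)) => k.
  apply: (@coeff_le (fun k => t ^+ k.-1 *+ k)); first by rewrite addr_ge0.
  rewrite normrMn normrX tE -rmorphXn -rmorphMn lecR.
  exact: mulrn_expr_pred_le.
pose g : C := g0.
pose M := A * expR (r * (s + 2)).
have M0 : 0 <= M by rewrite mulr_ge0 // expR_ge0.
have fM h : `|h| <= 1 -> `|f (t + h) - f t - h * g| <= `|h| ^+ 2 * M%:C.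
  move=> h1; pose u n := series (fun k => a k * (t + h) ^+ k) n
    - series (fun k => a k * t ^+ k) n - h * d n.
  apply: (@norm_lim_le _ u).
    by apply: cvgB; [apply: cvgB; exact: cf | apply: cvgM; [exact: cvg_cst|]].
  move=> n; rewrite /u /d /series /= mulr_sumr -!sumrB.
  apply: le_trans (ler_norm_sum _ _ _) _.
  apply: (@le_trans _ _ (`|h| ^+ 2 *
      (\sum_(0 <= k < n) A * exp_coeff (r * (s + 2)) k)%:C)).
    rewrite rmorph_sum mulr_sumr; apply: ler_sum => k _.
    rewrite mulrCA -!mulrBr normrM.
    apply: le_trans (ler_wpM2l (normr_ge0 _) (@expr_taylor2_le _ t h k h1)) _.
    rewrite mulrCA ler_wpM2l ?exprn_ge0 //.
    have -> : `|t| + 2 = (s + 2)%:C by rewrite rmorphD rmorph_nat tE.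
    rewrite -rmorphXn; have s2 : 0 <= s + 2 by rewrite addr_ge0.
    have := @coeff_le (fun k => ((s + 2) ^+ k)%:C) _ k s2.
    rewrite normrM norm_real_complex (ger0_norm (exprn_ge0 k s2)).
    by apply.
  by rewrite ler_wpM2l ?exprn_ge0 // lecR sum_le // addr_ge0.
suff : h^-1 *: (f (h *: (1 : C) + t) - f t) @[h --> 0^'] --> (g : C) by apply: cvgP.
apply/cvgrPdist_lt => _ /gt0_complexP[e e0 ->].
have M1 : 0 < M + 1 by rewrite ltr_wpDl.
(* The 1 keeps h in the range of the remainder bound; M + 1 replaces M, which may be zero. *)
have eM : 0 < (Num.min 1 (e / (M + 1)))%:C :> C.
  by rewrite -(rmorph0 (real_complex R)) ltcR lt_min ltr01 divr_gt0.
apply/nbhs_ballP; exists (Num.min 1 (e / (M + 1)))%:C => //= h.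
rewrite -ball_normE /= sub0r normrN => he h0.
have hE := normc_ReE h; set y := complex.Re `|h| in hE.
have /andP[y1 ye] : (y < 1) && (y < e / (M + 1)).
  by move: he; rewrite hE ltcR lt_min.
have y0 : y != 0 by apply: contra h0 => /eqP y0; rewrite -normr_eq0 hE y0.
have -> : g - h^-1 *: (f (h *: (1 : C) + t) - f t)
    = - (h^-1 * (f (t + h) - f t - h * g)).
  have -> : h *: (1 : C) = h by exact: mulr1.
  by rewrite [h + t]addrC mulrBr mulKf // opprB.
rewrite normrN normrM normfV.
have h1 : `|h| <= 1 by rewrite hE -(rmorph1 (real_complex R)) lecR ltW.
apply: (@le_lt_trans _ _ (`|h|^-1 * (`|h| ^+ 2 * M%:C))).
  by rewrite ler_wpM2l ?invr_ge0 // fM.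
rewrite expr2 -mulrA mulKf ?normr_eq0 // hE -rmorphM ltcR.
have yM : y * (M + 1) < e by rewrite -ltr_pdivlMr.
apply: le_lt_trans yM; rewrite ler_wpM2l ?lerDl //.
exact: Re_norm_ge0.
Qed.

End EntireSeries.

Lemma inv_coord_chart (C : numFieldType) (t : C) : inv_coord (chart_infty t) = t.
Proof. by rewrite /chart_infty; case: ifPn => [/eqP ->|_] /=; rewrite ?invrK. Qed.

(** * Divergence or convergence of phi *)

Section PhiHat.
Variables (R : realType) (beta1 beta2 gamma1 gamma2 : cplx R).
Local Notation C := (cplx R).
Local Notation "x %:C" := (real_complex R x : C).
Local Notation g := (gamma2 - gamma1).
Local Notation b := (beta2 - beta1).
Local Notation S := (partial_S beta1 beta2 gamma1 gamma2).
Local Notation phi := (phi_hat beta1 beta2 gamma1 gamma2).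
Local Notation B := (complex.Re `|b|).
Local Notation G := (complex.Re `|g|).

(** The summand of [partial_S]. Since [series] stops before its index, [S k] is [series T k.+1]. *)
Let T (n : nat) : C := (-1) ^+ n.+1 * g ^+ n * b ^+ n / (n`! * (n.+1)`!)%:R.

Let norm_T n : `|T n| = ((G * B) ^+ n / (n`! * n.+1`!)%:R)%:C.
Proof.
rewrite /T !normrM normfV !normrX normrN1 expr1n mul1r normr_nat.
rewrite (normc_ReE g) (normc_ReE b) -!rmorphXn -rmorphM -exprMn.
by rewrite fmorph_div rmorph_nat.
Qed.

Let GB0 : 0 <= G * B.
Proof. by rewrite mulr_ge0 // Re_norm_ge0. Qed.

(** Dropping one of the two factorials leaves the exponential series of |g b| as majorant. *)
Lemma is_cvg_partial_S : cvgn S.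
Proof.
have /cvg_ex[/= l cl] : cvgn (series T).
  apply: cvg_series_dominated (is_cvg_series_exp_coeff (G * B)) => n.
  rewrite norm_T lecR /exp_coeff /= ler_wpM2l ?exprn_ge0 //.
  rewrite lef_pV2 ?posrE ?ltr0n ?muln_gt0 ?fact_gt0 // ler_nat.
  by rewrite leq_pmulr ?fact_gt0.
suff : S @ \oo --> (l : C) by apply: cvgP.
by rewrite -(cvg_shiftS (series T)) in cl.
Qed.

Let tail_le k : limn S = 0 ->
  `|series T k| <= ((G * B) ^+ k / (k`! * k.+1`!)%:R * expR (G * B))%:C.
Proof.
move=> S0.
have cT : series T @ \oo --> (0 : C).
  have cS : S @ \oo --> limn S := is_cvg_partial_S.
  by rewrite S0 in cS; rewrite -cvg_shiftS.
(* The total sum is zero, so [series T k] is the limit of the negated finite tails [u n], and a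
   uniform bound on these is enough. *)
pose u n := series T k - series T (n + k)%N.
have -> : series T k = series T k - 0 by rewrite subr0.
apply: (@norm_lim_le _ u); first apply: cvgB; first exact: cvg_cst.
  by rewrite (cvg_shiftn k (series T)).
move=> {}n; rewrite /u -normrN opprB series_addn addrAC subrr add0r.
apply: le_trans (ler_norm_sum _ _ _) _.
rewrite -{1}[k]add0n big_addn addnK.
under eq_bigr do rewrite norm_T.
rewrite -rmorph_sum lecR.
apply: (@le_trans _ _ (\sum_(0 <= i < n)
    (G * B) ^+ k / (k`! * k.+1`!)%:R * exp_coeff (G * B) i)).
  (* The first tail term factors out because k! i! <= (i+k)! and (k+1)! <= (i+k+1)!; what remains is
     an exponential series. *)
  apply: ler_sum => i _; rewrite /exp_coeff /= mulrACA -exprD -invfM -natrM addnC.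
  rewrite ler_wpM2l ?exprn_ge0 //.
  rewrite lef_pV2 ?posrE ?ltr0n ?muln_gt0 ?fact_gt0 // ler_nat.
  rewrite mulnAC leq_mul //; last by rewrite leq_fact // ltnS leq_addr.
  by rewrite -(bin_fact (leq_addr i k)) addKn leq_pmull // bin_gt0 leq_addr.
rewrite -mulr_sumr ler_wpM2l ?divr_ge0 ?exprn_ge0 //.
apply: (@nondecreasing_cvgn_le _ (series (exp_coeff (G * B)))).
  by apply: nondecreasing_series => i _ _; rewrite exp_coeff_ge0.
exact: is_cvg_series_exp_coeff.
Qed.

Lemma norm_phi_hat_le k : gamma1 <> gamma2 -> limn S = 0 ->
  `|phi k| <= (expR (G * B) * (B ^+ k / k`!%:R))%:C.
Proof.
move=> /eqP; rewrite eq_sym -subr_eq0 => g0 S0.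
have B0 : 0 <= B by exact: Re_norm_ge0.
have G0 : G != 0 by apply: contra g0 => /eqP G0; rewrite -normr_eq0 normc_ReE G0.
(* Multiplying the tail bound by n! / G^n cancels one factorial and the powers of G; the remaining
   1/(n+1)! is weakened to 1/n!. *)
have key n (s E : R) : 0 <= E -> s <= (G * B) ^+ n / (n`! * n.+1`!)%:R * E ->
    n`!%:R * s / G ^+ n <= E * (B ^+ n / n`!%:R).
  move=> E0 sE; have G0' := Re_norm_ge0 g.
  have f0 m : m`!%:R != 0 :> R by rewrite pnatr_eq0 -lt0n fact_gt0.
  apply: (@le_trans _ _ (n`!%:R * ((G * B) ^+ n / (n`! * n.+1`!)%:R * E) / G ^+ n)).
    by rewrite ler_wpM2r ?invr_ge0 ?exprn_ge0 // ler_wpM2l.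
  rewrite (natrM _ n`! n.+1`!) exprMn.
  have -> : n`!%:R * (G ^+ n * B ^+ n / (n`!%:R * n.+1`!%:R) * E) / G ^+ n =
      E * (B ^+ n / n.+1`!%:R).
    have Gn : G ^+ n != 0 by rewrite expf_neq0.
    move: (n`!%:R) (n.+1`!%:R) (f0 n) (f0 n.+1) (G ^+ n) Gn => F F1 F0 F10 y y0.
    by field; rewrite F0 F10 y0.
  do 2!rewrite ler_wpM2l ?exprn_ge0 //.
  by rewrite lef_pV2 ?posrE ?ltr0n ?fact_gt0 // ler_nat leq_fact.
case: k => [|k].
  by rewrite normr0 -(rmorph0 (real_complex R)) lecR mulr_ge0 ?expR_ge0 // divr_ge0.
have -> : phi k.+1 = k.+1`!%:R * S k / g ^+ k.+1 by [].
rewrite normrM normfV normrX normrM normr_nat (normc_ReE g) (normc_ReE (S k)).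
rewrite -(rmorph_nat (real_complex R)) -rmorphXn -fmorphV -!rmorphM lecR.
apply: key; first exact: expR_ge0.
by have := tail_le k.+1 S0; rewrite (normc_ReE (series T k.+1)) lecR.
Qed.

Lemma phi_hat_divergent : gamma1 <> gamma2 -> limn S <> 0 -> fps_divergent phi.
Proof.
move=> /eqP; rewrite eq_sym -subr_eq0 => g0 S0 x x0 /cvg_series_cvg_0 phi0.
apply: S0; apply: cvg_lim; first exact: norm_hausdorff.
(* These are the terms of the exponential series at g x, which is entire with A = r = 1. *)
have gx0 : (fun k => (k`!%:R^-1 : C) * (g * x) ^+ k) @ \oo --> (0 : C).
  apply: cvg_series_cvg_0.
  apply: (@is_cvg_entire_series R (fun k => k`!%:R^-1) 1 1) => // k.
  by rewrite expr1n !mul1r normfV normr_nat fmorphV rmorph_nat.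
have : (fun k => phi k * x ^- k * (k`!%:R^-1 * (g * x) ^+ k)) @ \oo --> (0 : C).
  by rewrite -[X in _ --> X](mulr0 0); exact: cvgM.
(* The product at index k+1 is exactly [S k]; the shift skips the conventional phi_0 = 0. *)
rewrite -cvg_shiftS; apply: cvg_trans; apply: near_eq_cvg; apply: nearW => k /=.
rewrite /phi_hat /=.
have f0 : k.+1`!%:R != 0 :> C by rewrite pnatr_eq0 -lt0n fact_gt0.
have gn : g ^+ k.+1 != 0 by rewrite expf_neq0.
have xn : x ^+ k.+1 != 0 by rewrite expf_neq0.
rewrite exprMn; move: k.+1`!%:R (g ^+ k.+1) (x ^+ k.+1) f0 gn xn => F y z F0 y0 z0.
by field; rewrite F0 y0 z0.
Qed.

Lemma phi_hat_analytic : gamma1 <> gamma2 -> limn S = 0 ->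
  exists F : CP1 C -> C, fps_sums_to_on [set p | p <> Some 0] phi F
    /\ analytic_on [set p | p <> Some 0] F.
Proof.
move=> g0 S0.
have B0 : 0 <= B by exact: Re_norm_ge0.
have E0 : 0 <= expR (G * B) by exact: expR_ge0.
have phiE k := @norm_phi_hat_le k g0 S0.
pose f z : C := limn (series (fun k => phi k * z ^+ k)).
have df z : derivable f z 1 by exact: derivable_entire_series phiE z.
(* The entire function f is evaluated at 1/x. Away from 0 and infinity this is a composite of
   differentiable maps; in the chart at infinity it is f itself. *)
exists (f \o @inv_coord C); split=> [p _|[z|] /= pz].
- exact: is_cvg_entire_series phiE _.
- have z0 : z != 0 by apply: contra_notN pz => /eqP ->.
  have z_near := @cvgr_neq0 C C C (nbhs z) _ id z cvg_id z0.
  rewrite /analytic_at; near=> w; have w0 : w != 0 by near: w; exact: z_near.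
  apply/derivable1_diffP; apply: differentiable_comp; apply/derivable1_diffP => //.
  by apply: derivableV => //; exact: derivable_id.
have -> : (fun t => f (inv_coord (chart_infty t))) = f.
  by apply/funext => t; rewrite inv_coord_chart.
by rewrite /analytic_at; near=> w; exact: df.
Unshelve. all: by end_near. Qed.

End PhiHat.

(** * Both cases through one scalar series p *)

Theorem proposition3p5 (R : realType) (beta1 beta2 gamma1 gamma2 : cplx R)
    (hbeta : beta1 <> beta2) :
  let b := beta2 - beta1 in
  let S := partial_S beta1 beta2 gamma1 gamma2 in
  let phi := phi_hat beta1 beta2 gamma1 gamma2 in
  (exists P : 'M[fps (cplx R)]_2,
    [/\ fundamental_matrix_infty beta1 beta2 gamma1 gamma2
          (Phi_infty beta1 beta2 gamma1 gamma2 P),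
        forall Q : 'M[fps (cplx R)]_2,
          fundamental_matrix_infty beta1 beta2 gamma1 gamma2
            (Phi_infty beta1 beta2 gamma1 gamma2 Q) -> Q = P,
        gamma1 = gamma2 ->
          P = mx2 1 (fps_cst b^-1 * (fps_exp (- b) - 1)) 0 1
      & gamma1 <> gamma2 ->
          P = mx2 1 (- (fps_xinv (cplx R) * phi)) 0 1])
  /\ (gamma1 <> gamma2 ->
      [/\ cvgn S,
          limn S <> 0 -> fps_divergent phi
        & limn S = 0 ->
          exists F : CP1 (cplx R) -> cplx R,
            fps_sums_to_on [set p | p <> Some 0] phi F
            /\ analytic_on [set p | p <> Some 0] F]).
Proof.
move=> b S phi; split; last first.
  move=> g0; split.
  - exact: is_cvg_partial_S.
  - exact: phi_hat_divergent.
  - exact: phi_hat_analytic.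
(* Existence and uniqueness of P need only a solution p with the right constant term; the two cases
   differ just in its closed form. *)
suff [p [pE p0 p1 p2]] : exists p : fps (cplx R),
    [/\ fps_deriv p + fps_cst (gamma2 - gamma1) * p
         = fps_xinv (cplx R) ^+ 2 * fps_exp (- b),
       gamma2 = gamma1 -> p 0%N = 0,
       gamma1 = gamma2 -> p = fps_cst b^-1 * (fps_exp (- b) - 1)
     & gamma1 <> gamma2 -> p = - (fps_xinv (cplx R) * phi)].
  have Pinf := fundamental_matrix_infty_mx2 _ _ _ _ _ _ pE p0.
  exists (mx2 1 p 0 1); split=> // [Q Qinf|/p1 ->//|/p2 ->//].
  apply: (Phi_infty_inj _ beta1 beta2 gamma1 gamma2).
  exact: fundamental_matrix_infty_unique Qinf Pinf.
have b0 : b != 0 by rewrite subr_eq0 eq_sym; apply/eqP.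
have [g0|g0] := eqVneq gamma1 gamma2.
  have [dp p0] := @fps_exp_primitive _ b b0.
  exists (fps_cst b^-1 * (fps_exp (- b) - 1)); split=> //.
  by rewrite g0 subrr fps_cst0 mul0r addr0.
exists (- (fps_xinv (cplx R) * phi)); split=> //.
- exact: phi_hat_ode.
- by move=> g; rewrite g eqxx in g0.
- by move=> g; rewrite g eqxx in g0.
Qed.
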